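(* Let $G$ be a graph with a unique perfect matching. Then $G$ is a Sterboul--Deming graph if and only if $G$ has no leaves (vertices of degree $1$).
   Context: All graphs are finite, undirected and simple. Let $M$ be a matching of a graph $G$. A path (or walk) is $M$-alternating if, of any two consecutive edges, exactly one belongs to $M$; an $mm$-$M$-path is an $M$-alternating path whose first and last edges are in $M$. An $M$-blossom is an odd cycle of length $2k+1$ with exactly $k$ edges in $M$; its base is the unique vertex of the cycle not covered by those $k$ edges. An $M$-Tflower consists of an $M$-blossom together with an $M$-stem, i.e. an $M$-alternating path of even length (possibly zero) connecting the base of the blossom to a vertex not saturated by $M$ in $G$, where the base is the only common vertex of the blossom and the stem. An $M$-Tposy consists of two $M$-blossoms joined by an $mm$-$M$-path whose endpoints are the bases of the two blossoms, such that no internal vertex of the path lies in the blossoms and the intersection of the two blossoms is either empty or an $mm$-$M$-path. Define $SD(G)$ as the set of vertices $v$ of $G$ for which there is a maximum matching $M$ of $G$ such that $v$ lies in an $M$-Tflower or an $M$-Tposy, and $KE(G)=V(G)\setminus SD(G)$. A graph $G$ is a Sterboul--Deming graph if $KE(G)=\emptyset$. *)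

(* Defs.v *)
From HB Require Import structures.
From mathcomp Require Import all_boot.
From mathcomp Require Import boolp.

Set Implicit Arguments.
Unset Strict Implicit.
Unset Printing Implicit Defensive.

Record sgraph := SGraph {
  vertex :> finType;
  adj : rel vertex;
  adj_sym : symmetric adj;
  adj_irrefl : irreflexive adj
}.

Section Graph.

Variable G : sgraph.
Implicit Types (M : {set {set G}}) (x b v : G) (p c : seq G).

Definition edges : {set {set G}} := [set [set u.1; u.2] | u : G * G & adj u.1 u.2].

Definition leaf v : bool := #|[set y | adj v y]| == 1.

(** [trivIset M] says that distinct members of [M] are disjoint. *)
Definition matching M : bool := (M \subset edges) && trivIset M.

Definition saturated M v : bool := v \in cover M.

Definition perfect_matching M : Prop := matching M /\ forall v, saturated M v.

Definition maximum_matching M : Prop :=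
  matching M /\ forall M', matching M' -> #|M'| <= #|M|.

(** A path is given by its first vertex [x] and the sequence [p] of the
    remaining ones; its length (number of edges) is therefore [size p]. *)
Definition gpath x p : bool := path (@adj G) x p && uniq (x :: p).

Definition path_edges x p : seq {set G} := pairmap (fun u w => [set u; w]) x p.

Definition alternating M x p : bool :=
  sorted (fun f g => (f \in M) (+) (g \in M)) (path_edges x p).

(** The default [set0] is never returned, as there is at least one edge. *)
Definition mm_path M x p : Prop :=
  [/\ gpath x p, alternating M x p, 0 < size p,
      head set0 (path_edges x p) \in M & last set0 (path_edges x p) \in M].

(** A cycle is given by the sequence of its vertices in cyclic order. *)
Definition gcycle c : bool := [&& ucycleb (@adj G) c & 2 < size c].

Definition cycle_edges c : {set {set G}} := [set [set x; next c x] | x in c].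

Definition blossom M c : Prop :=
  gcycle c /\ exists k, size c = k.*2.+1 /\ #|cycle_edges c :&: M| = k.

Definition blossom_base M c b : Prop :=
  [set x in c | x \notin cover (cycle_edges c :&: M)] = [set b].

(** [c] is the blossom, with base [b], and [b :: p] is the stem. *)
Definition Tflower M c b p : Prop :=
  [/\ blossom M c /\ blossom_base M c b,
      gpath b p /\ alternating M b p,
      ~~ odd (size p),
      ~~ saturated M (last b p)
    & [set x in c] :&: [set x in b :: p] = [set b]].

(** The intersection of two cycles is taken as subgraphs. *)
Definition cycles_disjoint c1 c2 : Prop := [set x in c1] :&: [set x in c2] = set0.

Definition cycles_meet_in_path c1 c2 x p : Prop :=
  [set y in c1] :&: [set y in c2] = [set y in x :: p] /\
  cycle_edges c1 :&: cycle_edges c2 = [set f in path_edges x p].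

(** [c1] and [c2] are the blossoms, [b] is the base of [c1], and [b :: p] is
    the path joining [b] to the base of [c2]. *)
Definition Tposy M c1 c2 b p : Prop :=
  [/\ blossom M c1 /\ blossom_base M c1 b,
      blossom M c2 /\ blossom_base M c2 (last b p),
      mm_path M b p,
      forall x, x \in b :: p -> x != b -> x != last b p ->
        (x \notin c1) && (x \notin c2)
    & cycles_disjoint c1 c2 \/
      exists x q, mm_path M x q /\ cycles_meet_in_path c1 c2 x q].

Definition in_Tflower M v : Prop :=
  exists c b p, Tflower M c b p /\ (v \in c \/ v \in b :: p).

Definition in_Tposy M v : Prop :=
  exists c1 c2 b p, Tposy M c1 c2 b p /\ [\/ v \in c1, v \in c2 | v \in b :: p].

Definition SD : {set G} :=
  [set v | `[< exists M, maximum_matching M /\ (in_Tflower M v \/ in_Tposy M v) >]].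

Definition KE : {set G} := [set: G] :\: SD.

End Graph.

Arguments SD : clear implicits.
Arguments KE : clear implicits.

Definition sterboul_deming (G : sgraph) : Prop := KE G = set0.

(* Main.v *)
Require Import Defs.
From HB Require Import structures.
From mathcomp Require Import all_boot.
From mathcomp Require Import boolp.

(** Let [M] be the perfect matching and [m x] the [M]-mate of [x].  Uniqueness
    of [M] says exactly that there is no [M]-alternating cycle.  Record an
    alternating path [m z_0, z_0, m z_1, z_1, ..., m z_n, z_n] by the sequence
    [z_0, ..., z_n], and take it inextensible.  As there are no leaves, [z_n] has
    a neighbour other than its mate; it lies on the path, and it is some [z_k]
    with [k < n], since a neighbour [m z_k] would close an alternating cycle.
    Likewise [m z_0] has a neighbour [m z_j] with [0 < j].  If [j <= k], the two
    odd cycles so closed are disjoint and form a Tposy that contains the whole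
    path.  If [k < j], then [z_0, ..., z_k, m z_n, ..., m z_j] records an
    alternating cycle, a contradiction. *)

Set Implicit Arguments.
Unset Strict Implicit.
Unset Printing Implicit Defensive.

Lemma cat_eq_cat (T : Type) (s1 s2 t1 t2 : seq T) :
  s1 ++ s2 = t1 ++ t2 -> size t1 <= size s1 ->
  exists u, s1 = t1 ++ u /\ t2 = u ++ s2.
Proof.
elim: t1 s1 => [|x t1 IH] [|y s1] //=; first by exists [::].
  by exists (y :: s1).
by move=> [-> /IH] {}IH /IH [u [-> ->]]; exists u.
Qed.

(** * Perfect matchings and their mate functions *)

Section Matchings.

Variable G : sgraph.
Implicit Types (M N : {set {set G}}) (x y v : G).

Lemma pair_edgesE x y : ([set x; y] \in edges G) = adj x y.
Proof.
apply/imsetP/idP => [[[a b]]|xy]; last by exists (x, y); rewrite ?inE.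
rewrite inE /= => ab eq_xy.
have: a \in [set x; y] by rewrite eq_xy set21.
have: b \in [set x; y] by rewrite eq_xy set22.
by move: ab => + /set2P[] eb /set2P[] ea; rewrite ea eb ?adj_irrefl // adj_sym.
Qed.

Lemma card_cover_matching M : matching M -> #|cover M| = #|M| * 2.
Proof.
case/andP=> /subsetP sME /eqP <-; rewrite -sum_nat_const.
apply: eq_bigr => _ /sME/imsetP[[a b] + ->]; rewrite inE cards2 /=.
by case: eqP => // ->; rewrite adj_irrefl.
Qed.

Lemma perfect_cover M : perfect_matching M -> cover M = [set: G].
Proof. by case=> _ satM; apply/setP=> v; rewrite inE; apply: satM. Qed.

Lemma perfect_maximum M : perfect_matching M -> maximum_matching M.
Proof.
move=> pM; have [mM _] := pM; split=> // N mN.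
rewrite -(leq_pmul2r (ltn0Sn 1)) -!card_cover_matching //.
by rewrite (perfect_cover pM) subset_leq_card ?subsetT.
Qed.

(** A matching covers two vertices per edge, so a maximum matching covers as many as a perfect one,
    hence all. This excludes Tflowers, whose stem ends at an unsaturated vertex. *)
Lemma maximum_saturated M N v :
  perfect_matching M -> maximum_matching N -> saturated N v.
Proof.
move=> pM [mN maxN]; have [mM _] := pM.
rewrite /saturated; suff -> : cover N = [set: G] by rewrite inE.
apply/eqP; rewrite eqEcard subsetT -(perfect_cover pM) !card_cover_matching //.
by rewrite leq_pmul2r ?maxN.
Qed.

Definition mate_fun M m : Prop := forall x y, ([set x; y] \in M) = (y == m x).

Lemma perfect_mate_fun M : perfect_matching M -> exists m, mate_fun M m.
Proof.
case=> /andP[/subsetP sME tM] satM.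
have mateM x : exists y, [set x; y] \in M.
  have /bigcupP[f fM xf] := satM x.
  have /imsetP[[a b] _ /= eq_f] := sME _ fM.
  move: xf fM; rewrite eq_f !inE => /orP[]/eqP-> abM; first by exists b.
  by exists a; rewrite setUC.
have [m mM] := choice mateM; exists m => x y.
apply/idP/eqP => [xyM | -> //].
have eq_xy : [set x; y] = [set x; m x].
  by rewrite -(def_pblock tM xyM (set21 _ _)) (def_pblock tM (mM x) (set21 _ _)).
have := set22 x (m x); rewrite -eq_xy !inE => /orP[]/eqP // mx.
by have := sME _ (mM x); rewrite pair_edgesE mx adj_irrefl.
Qed.

(** Turns uniqueness of the perfect matching into uniqueness of an involution along edges, the form
    in which edge exchanges are carried out. *)
Lemma involution_perfect (m : G -> G) :
  involutive m -> (forall x, adj x (m x)) ->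
  exists2 M, perfect_matching M & mate_fun M m.
Proof.
move=> mK adjm; pose M := [set [set x; m x] | x in [set: G]].
have blockM f x : f \in M -> x \in f -> f = [set x; m x].
  case/imsetP=> y _ -> /set2P[] -> //.
  by rewrite mK setUC.
exists M.
  split; last first.
    move=> v; apply/bigcupP; exists [set v; m v]; last exact: set21.
    by apply: imset_f; rewrite inE.
  apply/andP; split.
    by apply/subsetP=> _ /imsetP[x _ ->]; rewrite pair_edgesE.
  apply/trivIsetP=> f g fM gM; apply: contraNT.
  case/pred0Pn => x /andP[/= xf xg].
  by rewrite (blockM f x) // (blockM g x).
move=> x y; apply/idP/eqP => [xyM | ->]; last by apply: imset_f; rewrite inE.
have eq_xy := blockM _ x xyM (set21 _ _).
have := set22 x (m x); rewrite -eq_xy !inE => /orP[]/eqP // mx.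
by have := adjm x; rewrite mx adj_irrefl.
Qed.

End Matchings.

(** * Cycles and interiors of paths avoid leaves *)

Section NoLeaf.

Variable G : sgraph.
Implicit Types (M : {set {set G}}) (v b : G) (c p : seq G).

Lemma leafF v x y : adj v x -> adj v y -> x != y -> ~~ leaf v.
Proof.
move=> vx vy; apply: contraNN => /cards1P[z /setP nz].
by have := nz x; have := nz y; rewrite !inE vx vy => /esym/eqP-> /esym/eqP->.
Qed.

Lemma non_leaf_neighbour v x : adj v x -> ~~ leaf v -> exists2 y, adj v y & y != x.
Proof.
move=> vx; have [/existsP[y /andP[]]|/existsPn nvx] :=
  boolP [exists y, adj v y && (y != x)]; first by exists y.
case/negP; apply/cards1P; exists x; apply/setP => y; rewrite !inE.
have := nvx y; rewrite negb_and negbK; case: eqP => [->|_]; rewrite ?vx //.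
by rewrite orbF => /negbTE.
Qed.

(** The two cyclic neighbours of [v] are distinct because the cycle has at least three vertices. *)
Lemma cycle_leafF c v : gcycle c -> v \in c -> ~~ leaf v.
Proof.
case/andP=> /andP[cyc_c uc] sz_c /rot_to[i s def_s].
move: cyc_c uc sz_c; rewrite -(rot_cycle i) -(rot_uniq i) -(size_rot i) def_s.
case: s {def_s} => [|x s] //; case/lastP: s => [|s y] //.
rewrite (cycle_path v) /= last_rcons => /and3P[yv vx _] /and3P[_ xs _] _.
apply: (leafF vx (y := y)); first by rewrite adj_sym.
by apply: contraNneq xs => ->; rewrite mem_rcons mem_head.
Qed.

Lemma gpath_leafF b p v :
  gpath b p -> v \in b :: p -> v != b -> v != last b p -> ~~ leaf v.
Proof.
move=> /andP[+ +] + v_b; rewrite inE (negbTE v_b) orFb => + + /splitPr def_p.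
case: def_p => p1 [|y p2]; first by rewrite last_cat eqxx.
rewrite cat_path -cat_cons cat_uniq => /and4P[_ xv vy _] /and3P[_ /hasPn yp _] _.
have {}yp: y \notin b :: p1 by apply: yp; rewrite !inE eqxx orbT.
apply: (leafF _ vy (x := last b p1)); first by rewrite adj_sym.
by apply: contraNneq yp => <-; apply: mem_last.
Qed.

End NoLeaf.

(** * Alternating paths under a unique perfect matching *)

Section AlternatingPaths.

Variables (G : sgraph) (m : G -> G).
Hypotheses (mK : involutive m) (adjm : forall x, adj x (m x)).
Implicit Types (x y w b : G) (s t c : seq G).

(** [s] records the alternating path [expand s]; [step x y] says that [m x, x]
    may be followed by [m y, y]. *)
Definition step x y := adj x (m y) && (x != y).

Fixpoint expand s := if s is x :: s' then [:: m x, x & expand s'] else [::].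

Lemma mate_neq x : m x != x.
Proof. by apply/eqP => mx; have := adjm x; rewrite mx adj_irrefl. Qed.

Lemma step_mate x y : step (m y) (m x) = step x y.
Proof. by rewrite /step mK adj_sym (inj_eq (inv_inj mK)) eq_sym. Qed.

Lemma expand_cat s t : expand (s ++ t) = expand s ++ expand t.
Proof. by elim: s => //= x s ->. Qed.

Lemma mem_expand s y : (y \in expand s) = (y \in s) || (m y \in s).
Proof.
elim: s => //= x s IH; rewrite !inE IH (can2_eq mK mK).
by do !case: (_ == _); case: (_ \in _).
Qed.

Lemma mem_expand_mate s y : (m y \in expand s) = (y \in expand s).
Proof. by rewrite !mem_expand mK orbC. Qed.

(** Read backwards, each pair [m x, x] becomes [x, m x], so the reversed path is recorded by mates.
    This is the symmetry between the two ends. *)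
Lemma expand_rev_mate s : expand (rev (map m s)) = rev (expand s).
Proof.
elim: s => // x s IH; rewrite [map _ _]/= rev_cons -cats1 expand_cat IH.
by rewrite -[x :: s]cat1s expand_cat rev_cat /expand /= mK.
Qed.

Lemma uniq_expand_cons x s :
  uniq (expand (x :: s)) = (x \notin expand s) && uniq (expand s).
Proof.
by rewrite /= inE (negbTE (mate_neq x)) mem_expand_mate /= andbA andbb.
Qed.

Lemma uniq_expand s : uniq (expand s) -> uniq s.
Proof.
elim: s => // x s IH; rewrite uniq_expand_cons /= => /andP[+ /IH ->].
by rewrite mem_expand negb_or => /andP[-> _].
Qed.

Lemma sorted_rev_mate s : sorted step (rev (map m s)) = sorted step s.
Proof.
by rewrite rev_sorted sorted_map; apply: eq_sorted => x y; apply: step_mate.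
Qed.

Lemma path_rev_mate x y s :
  path step x (rcons (rev (map m s)) y) = path step (m y) (rcons s (m x)).
Proof.
elim: s y => [|z s IH] y /=; first by rewrite !andbT step_mate.
rewrite rev_cons rcons_path last_rcons IH.
by rewrite mK -(step_mate (m y)) mK andbC.
Qed.

Lemma expand_mateF s x : uniq (expand s) -> x \in s -> m x \notin s.
Proof.
elim: s => // y s IH; rewrite uniq_expand_cons mem_expand negb_or.
case/andP=> /andP[ys mys] us; rewrite !inE.
have [-> _|xy /= xs] := eqVneq x y; first by rewrite negb_or mate_neq.
rewrite negb_or IH // andbT; apply: contraNneq mys => <-.
by rewrite mK.
Qed.

Hypothesis m_unique :
  forall m', involutive m' -> (forall x, adj x (m' x)) -> m' =1 m.

(** Exchanging the matching and the non-matching edges along an alternating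
    cycle gives another perfect matching. *)
Lemma no_alternating_cycle x s : uniq (expand (x :: s)) -> ~~ cycle step (x :: s).
Proof.
set c := x :: s => uc; apply/negP => cyc_c.
have uniq_c := uniq_expand uc.
have mcF y : y \in c -> (m y \in c) = false.
  by move=> yc; apply/negbTE/expand_mateF.
(* A recorded vertex is re-matched with the vertex after it on the cycle, and a mate of a recorded
   vertex with the vertex before it. *)
pose m' y := if y \in c then m (next c y)
             else if m y \in c then prev c (m y) else m y.
have m'K : involutive m'.
  move=> y; rewrite {2}/m'; case: ifP => [yc|ycF].
    by rewrite /m' mcF ?mem_next // mK mem_next yc prev_next.
  case: ifP => [myc|mycF]; first by rewrite /m' mem_prev myc next_prev // mK.
  by rewrite /m' mycF mK ycF.
have adjm' y : adj y (m' y).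
  rewrite /m'; case: ifP => [yc|ycF]; first by have /andP[] := next_cycle cyc_c yc.
  case: ifP => [myc|mycF]; last exact: adjm.
  by have /andP[] := prev_cycle cyc_c myc; rewrite mK adj_sym.
have /= xc : x \in c by rewrite inE eqxx.
have := m_unique m'K adjm' x; rewrite /m' xc => /(inv_inj mK) nx.
by have /andP[_] := next_cycle cyc_c xc; rewrite nx eqxx.
Qed.

Lemma neighbour_of_last x s w :
  sorted step s -> uniq (expand s) ->
  adj (last x s) w -> w != m (last x s) -> w \in expand s ->
  exists s1 y s2, s = rcons s1 w ++ y :: s2.
Proof.
move=> ps us lw wml; rewrite mem_expand => /orP[ws|mws].
  case/splitPr: ws lw us ps wml => s1 [|y s2]; last by exists s1, y, s2; rewrite cat_rcons.
  by rewrite last_cat /= adj_irrefl.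
case/splitPr: mws ps us lw wml => s1 s2 /cat_sorted2[_ ps].
rewrite last_cat expand_cat cat_uniq => /and3P[_ _ us] /= lw wml.
(* The edge to [w] closes the part from [m w] on. The only condition of [step] that can fail is
   [last != m w], but equality would make [w] the mate of the last vertex. *)
have := no_alternating_cycle us; rewrite /= rcons_path.
rewrite -/(sorted step (m w :: s2)) ps /step mK lw /= negbK => /eqP lmw.
by rewrite lmw mK in wml lw; rewrite eqxx in wml.
Qed.

(** This is [neighbour_of_last] applied to the reversed path. *)
Lemma neighbour_of_head x s w :
  sorted step s -> uniq (expand s) ->
  adj (m (head x s)) w -> w != head x s -> w \in expand s ->
  exists s1 y s2, s = rcons s1 y ++ m w :: s2.
Proof.
move=> ps us xw wx ws; have lt : last (m x) (rev (map m s)) = m (head x s).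
  by case: (s) => [|y s'] //=; rewrite rev_cons last_rcons.
have [|||||s1 [y [s2 def_s]]] := @neighbour_of_last (m x) (rev (map m s)) w.
- by rewrite sorted_rev_mate.
- by rewrite expand_rev_mate rev_uniq.
- by rewrite lt.
- by rewrite lt mK.
- by rewrite expand_rev_mate mem_rev.
exists (rev (map m s2)), (m y), (rev (map m s1)).
rewrite -[LHS](mapK mK) -[map m s]revK def_s.
by rewrite map_rev map_cat map_rcons rev_cat rev_rcons /= rev_cons.
Qed.

Lemma uniq_expand_skip s t u :
  uniq (expand (s ++ t ++ u)) -> uniq (expand (s ++ rev (map m u))).
Proof.
rewrite !expand_cat expand_rev_mate !cat_uniq rev_uniq has_cat negb_or.
case/and3P=> -> /andP[_ dis] /and3P[_ _ ->]; rewrite andbT /=.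
by apply: contra dis => /hasP[y]; rewrite mem_rev => yu ys; apply/hasP; exists y.
Qed.

(** The two ends of [s] fold back at [a] and at [m b].  If [a] came before
    [b], the part of [s] up to [a] followed by the reverse of the part from [b]
    on would be an alternating cycle. *)
Lemma folded_path_split x s a b :
  sorted step s -> uniq (expand s) ->
  adj (last x s) a -> adj (m (head x s)) (m b) ->
  (exists s1 y s2, s = rcons s1 a ++ y :: s2) ->
  (exists s1 y s2, s = rcons s1 y ++ b :: s2) ->
  exists s1 s2 s3, s = s1 ++ s2 ++ s3 /\
    [/\ s1 != [::], s3 != [::], s2 != [::], head x s2 = b & last x s2 = a].
Proof.
move=> ps us la hb [s1 [y [s2 def_s]]] [t1 [z [t2 def_t]]].
have eq_st : rcons s1 a ++ y :: s2 = rcons t1 z ++ b :: t2 by rewrite -def_s.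
have [lt_ts | le_st] := ltnP (size (rcons t1 z)) (size (rcons s1 a)).
  (* Here [b] comes no later than [a]; the nonempty difference of the two prefixes is the middle
     part, from [b] to [a]. *)
  have [[|b' u] [def_s1 def_t2]] := cat_eq_cat eq_st (ltnW lt_ts).
    by rewrite def_s1 cats0 ltnn in lt_ts.
  exists (rcons t1 z), (b' :: u), (y :: s2); rewrite -def_t2 def_t; split=> //.
  split=> //; first by case: (t1).
    by case: def_t2 => ->.
  by have := last_rcons x s1 a; rewrite def_s1 last_cat.
have [u [def_t1 def_s2]] := cat_eq_cat (esym eq_st) le_st.
move: ps la hb; rewrite def_s def_s2.
have [h [s1' def_h]] : exists h s1', rcons s1 a = h :: s1'.
  by case: (s1) => [|h r]; [exists a, [::] | exists h, (rcons r a)].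
have last_s1 : last h s1' = a by rewrite -(last_rcons h s1 a) def_h.
rewrite def_h !last_cat /= cat_path last_s1 => /andP[ps1 ps2] la hb.
(* The stretch [u] strictly between [a] and [b] is left out of the cycle. *)
have uc : uniq (expand (h :: s1' ++ rev (map m (b :: t2)))).
  apply: (@uniq_expand_skip (h :: s1') u).
  by rewrite -def_s2 -def_h -def_s.
case/negP: (no_alternating_cycle uc).
rewrite -[cycle _ _]/(path step h (rcons (_ ++ _) h)) rcons_cat cat_path ps1.
rewrite last_s1 path_rev_mate rcons_path /=.
have /andP[_ /= /andP[_ ->]] : path step a u && path step (last a u) (b :: t2).
  by rewrite -cat_path.
rewrite /step mK la hb /=.
(* Supplies the inequalities that [step] requires at the two junctions of the cycle. *)
have mF w1 w2 : w1 \in s -> w2 \in s -> w2 != m w1.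
  by move=> w1s w2s; apply: contraTneq w2s => ->; apply: expand_mateF.
have a_s : a \in s by rewrite def_s mem_cat mem_rcons mem_head.
have hs : h \in s by rewrite def_s def_h mem_head.
have st2 w : w \in b :: t2 -> w \in s by rewrite def_t mem_cat orbC => ->.
by rewrite [m h == b]eq_sym !mF // st2 ?mem_last ?mem_head.
Qed.

End AlternatingPaths.

(** * Blossoms and Tposies from recorded paths *)

Section Tposies.

Variables (G : sgraph) (m : G -> G) (M : {set {set G}}).
Hypotheses (mK : involutive m) (adjm : forall x, adj x (m x)).
Hypothesis mM : mate_fun M m.
Implicit Types (x y w b v : G) (s t c : seq G).

Local Notation step := (step m).
Local Notation expand := (expand m).

Lemma mate_edge x : [set x; m x] \in M.
Proof. by rewrite mM. Qed.

Lemma mate_edge_inj s :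
  uniq (expand s) -> {in s &, injective (fun x => [set x; m x])}.
Proof.
move=> us x y xs ys eq_xy.
have := set21 x (m x); rewrite eq_xy => /set2P[] // def_x.
by have := expand_mateF mK adjm us ys; rewrite -def_x xs.
Qed.

(** Matching edges join mates; [expand s] is closed under mates, while the mate of [b] is off the
    cycle. *)
Lemma blossom_edges b s :
  uniq (b :: expand s) ->
  cycle_edges (b :: expand s) :&: M = [set [set x; m x] | x in s].
Proof.
set c := b :: expand s => uc; apply/setP=> f; rewrite inE.
apply/andP/imsetP=> [[/imsetP[x xc ->]]|[x xs ->]].
  rewrite mM => /eqP nx.
  have mbF : (m b \in c) = false.
    rewrite inE (negbTE (mate_neq adjm b)) mem_expand_mate //.
    by case/andP: uc => /negbTE ->.
  have := xc; rewrite /c inE => /predU1P[xb | ].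
    by move: xc; rewrite -(mem_next c) nx xb mbF.
  rewrite mem_expand // => /orP[] xs; first by exists x; rewrite // nx.
  by exists (m x); rewrite // nx mK setUC.
split; last exact: mate_edge.
(* The edge is the one leaving [m x], since [expand] puts [x] right after [m x]. *)
apply/imsetP; exists (m x); first by rewrite inE mem_expand_mate // mem_expand // xs orbT.
rewrite setUC; congr [set _; _].
move: uc; rewrite /c; case/splitPr: xs => s1 s2; rewrite expand_cat -cat_cons.
set p := b :: expand s1 => uc.
by rewrite -(next_rot (size p) uc) rot_size_cat /= eqxx.
Qed.

Lemma size_expand s : size (expand s) = (size s).*2.
Proof. by elim: s => //= x s ->. Qed.

Lemma path_expand x s : path step x s -> path (@adj G) x (expand s).
Proof.
elim: s x => //= y s IH x /andP[/andP[-> _]] /IH ->.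
by rewrite adj_sym adjm.
Qed.

Lemma last_expand x s : last x (expand s) = last x s.
Proof. by elim: s x => //=. Qed.

Lemma blossom_of_path b x s :
  path step x s -> uniq (b :: expand (x :: s)) ->
  adj b (m x) -> adj (last x s) b ->
  blossom M (b :: expand (x :: s)) /\ blossom_base M (b :: expand (x :: s)) b.
Proof.
move=> ps uc bx sb; have bF : b \notin expand (x :: s) by case/andP: uc.
have us : uniq (expand (x :: s)) by case/andP: uc.
split; last first.
  rewrite /blossom_base blossom_edges //; apply/setP=> y; rewrite [LHS]in_set in_set1.
  set C := cover _; have -> : (y \in C) = (y \in expand (x :: s)).
    rewrite mem_expand //; apply/bigcupP/orP => [[_ /imsetP[z zs ->] /set2P[]->]|[ys|mys]].
    - by left.
    - by right; rewrite mK.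
    - by exists [set y; m y]; [apply: imset_f | apply: set21].
    - by exists [set m y; m (m y)]; [apply: imset_f | rewrite mK set22].
  by rewrite in_cons; case: eqVneq => [->|_]; rewrite ?bF //= andbN.
split.
  rewrite /gcycle /ucycleb uc /= size_expand andbT rcons_path.
  by rewrite last_expand sb bx (adj_sym (m x)) adjm (path_expand ps).
exists (size (x :: s)); split; first by rewrite /= -/(expand (x :: s)) size_expand.
rewrite blossom_edges // card_in_imset; last exact: mate_edge_inj.
by apply/card_uniqP/(uniq_expand mK adjm).
Qed.

Lemma mm_path_expand x s :
  path step x s -> uniq (expand (x :: s)) ->
  mm_path M (m x) (x :: expand s).
Proof.
move=> ps us; split.
- rewrite /gpath us andbT /= adj_sym adjm /=.
  exact: path_expand.
- rewrite /alternating /=; have /andP[_] := us.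
  have : [set m x; x] \in M by rewrite setUC mate_edge.
  (* Only membership of the preceding edge in [M] matters, so it is generalized to make the
     induction pass from pair to pair. *)
  move: [set m x; x] => f fM _; elim: s x f fM ps {us} => //= y s IH x f fM.
  case/andP=> /andP[_ xy] ps; rewrite IH // ?[[set m y; y]]setUC ?mate_edge // mM.
  by rewrite fM (inj_eq (inv_inj mK)) eq_sym (negbTE xy).
- by [].
- by rewrite /= setUC mate_edge.
rewrite /=; have : [set m x; x] \in M by rewrite setUC mate_edge.
move: [set m x; x] => f fM; elim: s x f fM {ps us} => //= y s IH x f fM.
by rewrite IH // setUC mate_edge.
Qed.

(** The path of [s2] joins the bases [m (head x s2)] and [last x s2]. The first base closes the path
    of [s1] into a blossom, the second that of [s3]. *)
Lemma Tposy_of_split x s1 s2 s3 :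
  sorted step (s1 ++ s2 ++ s3) -> uniq (expand (s1 ++ s2 ++ s3)) ->
  s1 != [::] -> s2 != [::] -> s3 != [::] ->
  adj (last x (s1 ++ s2 ++ s3)) (last x s2) ->
  adj (m (head x (s1 ++ s2 ++ s3))) (m (head x s2)) ->
  {in expand (s1 ++ s2 ++ s3), forall v, in_Tposy M v}.
Proof.
case: s1 s2 s3 => [|x1 s1] [|x2 s2] [|x3 s3] // ps us _ _ _ + + v vt.
move: ps; rewrite !last_cat /= cat_path /= cat_path /=.
case/and5P=> p1 /andP[a12 _] p2 /andP[a23 _] p3 la hb.
pose t1 := x1 :: s1; pose t2 := x2 :: s2; pose t3 := x3 :: s3.
move: us vt; rewrite -/t1 -/t2 -/t3 !expand_cat !mem_cat !cat_uniq has_cat negb_or.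
case/and3P=> u1 /andP[/hasPn d12 /hasPn d13] /and3P[u2 /hasPn d23 u3] vt.
have m2 : m x2 \in expand t2 by rewrite mem_head.
have l2 : last x2 s2 \in expand t2 by rewrite mem_expand // mem_last.
exists (m x2 :: expand t1), (last x2 s2 :: expand t3), (m x2), (x2 :: expand s2).
have def_t2 : m x2 :: x2 :: expand s2 = expand t2 by [].
have last2 : last (m x2) (x2 :: expand s2) = last x2 s2 by rewrite /= last_expand.
split; last first.
  rewrite def_t2; case/or3P: vt => vt.
  - by apply: Or31; rewrite inE vt orbT.
  - exact: Or33.
  - by apply: Or32; rewrite inE vt orbT.
split; rewrite ?last2 ?def_t2.
- apply: blossom_of_path => //; last by rewrite adj_sym.
  by rewrite cons_uniq u1 andbT; apply: (d12 _ m2).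
- apply: blossom_of_path => //.
  by rewrite cons_uniq u3 andbT; apply: contraL l2 => /d23.
- exact: mm_path_expand.
- move=> w wt2 w_b w_l; rewrite !in_cons (negbTE w_b) (negbTE w_l) /=.
  by rewrite (d12 _ wt2) /=; apply: contraL wt2 => /d23.
left; apply/setP=> w; rewrite in_setI in_set in_set in_set0 !in_cons; apply/negbTE/negP.
case/andP=> /predU1P[->|w1] /predU1P[].
(* The bases differ: [s2] records [last x2 s2] but cannot record [m x2] along with [x2]. *)
- move=> eq_ml; have := expand_mateF mK adjm u2 (mem_head x2 s2).
  by rewrite eq_ml mem_last.
- by move=> /d23; rewrite m2.
- by move=> eq_w; move/negP: (d12 _ l2); rewrite -eq_w; apply.
- by move=> /d13/negP; apply.
Qed.

(** Induction on [n], which bounds the number of extensions still possible: the entries of [s] are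
    distinct, so [size s] never exceeds [#|G|]. *)
Lemma alternating_in_Tposy n s v :
  (forall m', involutive m' -> (forall x, adj x (m' x)) -> m' =1 m) ->
  (forall x : G, ~~ leaf x) -> #|G| < size s + n ->
  sorted step s -> uniq (expand s) -> v \in expand s -> in_Tposy M v.
Proof.
move=> m_unique noleaf; elim: n s => [|n IH] s.
  move=> + _ us; rewrite addn0 ltnNge.
  by rewrite -(card_uniqP (uniq_expand mK adjm us)) max_card.
move=> lt_n ps us vs; pose x := v.
have [w lw wml] := non_leaf_neighbour (adjm (last x s)) (noleaf _).
have [ws | wF] := boolP (w \in expand s); last first.
  (* Recording [m w] appends the pair [w, m w], entered at [w]. *)
  apply: (IH (rcons s (m w))); rewrite ?size_rcons ?addSnnS //.
  - case: (s) ps lw wml => //= y s' ps lw wml.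
    by rewrite rcons_path ps /step mK lw eq_sym -(can_eq mK) mK.
  - rewrite -cats1 expand_cat uniq_catC -expand_cat cat1s uniq_expand_cons //.
    by rewrite mem_expand_mate // wF.
  - by rewrite -cats1 expand_cat mem_cat vs.
have adjmx : adj (m (head x s)) (head x s) by rewrite adj_sym.
have [w' hw wh] := non_leaf_neighbour adjmx (noleaf _).
have [ws' | wF] := boolP (w' \in expand s); last first.
  apply: (IH (w' :: s)); rewrite ?addSnnS //.
  - case: (s) ps hw wh => //= y s' -> hw wh.
    by rewrite /step adj_sym hw wh.
  - by rewrite uniq_expand_cons // wF.
  - by rewrite /= !inE vs !orbT.
have sa := neighbour_of_last mK adjm m_unique ps us lw wml ws.
have sb := neighbour_of_head mK adjm m_unique ps us hw wh ws'.
have mhw : adj (m (head x s)) (m (m w')) by rewrite mK.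
have [s1 [s2 [s3 [def_s [n1 n3 n2 hs2 ls2]]]]] :=
  folded_path_split mK adjm m_unique ps us lw mhw sa sb.
rewrite def_s in ps us vs lw mhw.
by apply: (Tposy_of_split (x := x) ps us); rewrite ?hs2 ?ls2.
Qed.

End Tposies.

(** The ends of the joining path are bases and so lie on cycles; its other vertices have two
    neighbours on the path. *)
Lemma Tposy_leafF (G : sgraph) (M : {set {set G}}) c1 c2 b p (v : G) :
  Tposy M c1 c2 b p -> [\/ v \in c1, v \in c2 | v \in b :: p] -> ~~ leaf v.
Proof.
case=> [[[cyc1 _] base1] [[cyc2 _] base2] [gp _ _ _ _] _ _].
have b1 : b \in c1 by have := set11 b; rewrite -base1 inE => /andP[].
have l2 : last b p \in c2 by have := set11 (last b p); rewrite -base2 inE => /andP[].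
case=> [||vp]; try exact: cycle_leafF.
have [->|vb] := eqVneq v b; first exact: cycle_leafF b1.
have [->|vl] := eqVneq v (last b p); first exact: cycle_leafF l2.
exact: gpath_leafF gp vp vb vl.
Qed.

Theorem theorem3p1 (G : sgraph)
    (hG : exists! M : {set {set G}}, perfect_matching M) :
  sterboul_deming G <-> ~ (exists v : G, leaf v).
Proof.
have [M [pM M_unique]] := hG; split=> [sdG [v leaf_v]|noleaf].
  have: v \notin KE G by rewrite sdG inE.
  rewrite !inE andbT negbK => /asboolP[N [maxN []]].
    move=> [c [b [p [[_ _ _ nsat _] _]]]].
    by rewrite (maximum_saturated _ pM maxN) in nsat.
  by case=> [c1 [c2 [b [p [posy /(Tposy_leafF posy)]]]]]; rewrite leaf_v.
have [m mM] := perfect_mate_fun pM.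
have mK : involutive m by move=> x; apply/esym/eqP; rewrite -mM setUC mM.
have adjm x : adj x (m x).
  rewrite -pair_edgesE; have [/andP[/subsetP sME _] _] := pM.
  by apply: sME; rewrite mM.
apply/setP=> v; rewrite !inE andbT; apply/negbTE; rewrite negbK.
apply/asboolP; exists M; split; first exact: perfect_maximum; right.
(* The extension starts from the single matching edge at [v], so the final Tposy contains [v]. *)
apply: (alternating_in_Tposy mK adjm mM (n := #|G|) (s := [:: v])) => //.
- move=> m' m'K adjm'; have [N pN m'N] := involution_perfect m'K adjm'.
  by move=> x; apply/eqP; rewrite -mM (M_unique _ pN) m'N.
- by move=> x; apply/negP => leaf_x; apply: noleaf; exists x.
- by rewrite /= inE mate_neq.
- by rewrite /= !inE eqxx orbT.
Qed.
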